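(* For every even integer $n\geq 4$ and every integer $\delta$ with $\frac{n}{2}\le \delta\le n-1$, we have \[r_{\mathrm{odd}}(n,\delta;C_n)\ \leq\ \min\left\{2\delta-n+2,\ \frac{3\sqrt{2}}{2}\cdot\frac{\delta}{\sqrt{n}}+3\right\}.\]
   Context: Graphs are finite and simple; $v(G)$ and $\delta(G)$ denote the number of vertices and minimum degree of $G$. For graphs $G,H$, the odd-Ramsey number $r_{\mathrm{odd}}(G,H)$ is the minimum positive integer $r$ for which there is an edge-colouring of $G$ with $r$ colours (not required to be proper) such that every copy of $H$ in $G$ contains an odd number of edges of at least one colour. $C_n$ is the cycle on $n$ vertices. Define $r_{\mathrm{odd}}(n,\delta;C_n)=\min\{r_{\mathrm{odd}}(G,C_n): v(G)=n,\ \delta(G)\ge\delta\}$. *)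

(* Defs.v *)
From HB Require Import structures.
From mathcomp Require Import all_boot all_order all_algebra.
From mathcomp Require Import boolp classical_sets reals.

Set Implicit Arguments.
Unset Strict Implicit.
Unset Printing Implicit Defensive.

Import Order.TTheory GRing.Theory Num.Theory.

(* [nat_min P] is 0 when [P] is empty; [nat_minP] covers nonempty [P]. *)
Definition nat_min (P : nat -> Prop) : nat :=
  xget 0 (fun m => P m /\ forall k, P k -> m <= k).

Lemma nat_minP (P : nat -> Prop) :
  (exists m, P m) -> P (nat_min P) /\ forall k, P k -> nat_min P <= k.
Proof.
move=> [m Pm]; have exP : exists m, `[< P m >] by exists m; apply/asboolP.
have [k /asboolP Pk kmin] := ex_minnP exP.
rewrite /nat_min; case: xgetP => [x _ //|].
by move=> /(_ k) []; split=> // j Pj; apply: kmin; apply/asboolP.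
Qed.

Record sgraph := SGraph {
  vertex :> finType;
  adj : rel vertex;
  adj_sym : symmetric adj;
  adj_irr : irreflexive adj }.

Definition edges (G : sgraph) : {set {set G}} :=
  [set e | [exists x, exists y, adj x y && (e == [set x; y])]].

Definition degree (G : sgraph) (x : G) : nat := #|[set y | adj x y]|.

(* Degrees are less than [#|G|], so the default value [#|G|] does not affect
   the minimum unless [G] has no vertices. *)
Definition min_degree (G : sgraph) : nat :=
  \big[minn/#|G|]_(x : G) degree x.

Definition cycle_adj (n : nat) : rel 'I_n :=
  [rel i j | (i != j) && ((j == ordS i) || (i == ordS j))].

Lemma cycle_adj_sym n : symmetric (@cycle_adj n).
Proof. by move=> i j; rewrite /cycle_adj /= eq_sym orbC. Qed.

Lemma cycle_adj_irr n : irreflexive (@cycle_adj n).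
Proof. by move=> i; rewrite /cycle_adj /= eqxx. Qed.

(* The cycle C_n, for [3 <= n]. *)
Definition cycle_graph (n : nat) : sgraph :=
  SGraph (@cycle_adj_sym n) (@cycle_adj_irr n).

(* An embedding of [H] in [G] determines a copy of [H] in [G], and every copy
   arises in this way. *)
Definition embedding (H G : sgraph) (f : H -> G) : Prop :=
  injective f /\ forall x y, adj x y -> adj (f x) (f y).

Definition copy_edges (H G : sgraph) (f : H -> G) : {set {set G}} :=
  [set f @: (e : {set H}) | e in edges H].

(* A colouring is defined on all vertex sets, but only its values on
   [edges G] matter: [copy_edges f] is contained in [edges G]. *)
Definition odd_colouring (G H : sgraph) (r : nat) (c : {set G} -> 'I_r) : Prop :=
  forall f : H -> G, embedding f ->
    exists i : 'I_r, odd #|[set e in copy_edges f | c e == i]|.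

Definition odd_ramsey (G H : sgraph) : nat :=
  nat_min (fun r => 0 < r /\ exists c : {set G} -> 'I_r, odd_colouring H c).

Definition odd_ramsey_mindeg (n d : nat) (H : sgraph) : nat :=
  nat_min (fun r => exists G : sgraph,
    [/\ #|G| = n, d <= min_degree G & r = odd_ramsey G H]).

Lemma copy_edges_sub (H G : sgraph) (f : H -> G) :
  embedding f -> copy_edges f \subset edges G.
Proof.
move=> [_ homf]; apply/fintype.subsetP => e /imsetP[e']; rewrite inE.
move=> /existsP[x /existsP[y /andP[xy /eqP->]]] ->.
rewrite inE; apply/existsP; exists (f x); apply/existsP; exists (f y).
by rewrite homf //= imsetU1 imset_set1.
Qed.

Lemma odd_ramseyP (G H : sgraph) : edges H != finset.set0 ->
  (0 < odd_ramsey G H /\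
   exists c : {set G} -> 'I_(odd_ramsey G H), odd_colouring H c) /\
  forall r, 0 < r /\ (exists c : {set G} -> 'I_r, odd_colouring H c) ->
    odd_ramsey G H <= r.
Proof.
move=> /set0Pn[e eH]; apply: (nat_minP (P := fun r => 0 < r /\ _)).
exists #|{set G}|; split; first by apply/card_gt0P; exists finset.set0.
exists enum_rank => f _; exists (enum_rank (f @: e)).
suff -> : finset (fun e' => (e' \in copy_edges f) &&
    (enum_rank e' == enum_rank (f @: e))) = finset.set1 (f @: e).
  by rewrite cards1.
apply/setP => e'; rewrite !inE (inj_eq enum_rank_inj) andbC.
by case: eqP => //= ->; apply/imsetP; exists e.
Qed.

Lemma edges_cycle_graph n : 1 < n -> edges (cycle_graph n) != finset.set0.
Proof.
case: n => [//|[//|n]] _; apply/set0Pn.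
pose x0 : cycle_graph n.+2 := ord0; pose x1 : cycle_graph n.+2 := ordS ord0.
exists (finset.setU (finset.set1 x0) (finset.set1 x1)).
rewrite inE; apply/existsP; exists x0; apply/existsP; exists x1.
rewrite eqxx andbT; apply/andP; split; last by apply/orP; left; apply/eqP.
by apply/eqP => /(congr1 val); rewrite /= modn_small.
Qed.

Lemma odd_ramsey_mindegP (n d : nat) (H : sgraph) : d < n ->
  (exists G : sgraph, [/\ #|G| = n, d <= min_degree G &
     odd_ramsey_mindeg n d H = odd_ramsey G H]) /\
  forall G : sgraph, #|G| = n -> d <= min_degree G ->
    odd_ramsey_mindeg n d H <= odd_ramsey G H.
Proof.
move=> dn.
have adjS : symmetric [rel i j : 'I_n | i != j] by move=> i j /=; rewrite eq_sym.
have adjI : irreflexive [rel i j : 'I_n | i != j] by move=> i /=; rewrite eqxx.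
have [|Pmin minP] := @nat_minP (fun r => exists G : sgraph,
    [/\ #|G| = n, d <= min_degree G & r = odd_ramsey G H]); last first.
  by split=> // G Gn dG; apply: minP; exists G.
exists (odd_ramsey (SGraph adjS adjI) H), (SGraph adjS adjI).
split=> //; first exact: card_ord.
rewrite /min_degree /=; elim/big_rec: _ => [|i m _ dm].
  by rewrite card_ord ltnW.
rewrite leq_min dm andbT /degree.
suff -> : #|finset (fun y : 'I_n => i != y)| = n.-1.
  by rewrite -ltnS prednK // (leq_ltn_trans _ dn).
rewrite -[n in RHS]card_ord -(finset.cardsC1 i).
by apply: eq_card => y; rewrite !inE eq_sym.
Qed.

(* Main.v *)
(* Two graphs are coloured so that no Hamilton cycle [C] is even in every colour.

   Second bound, and first bound for large [d]: the vertices are an apex [v] and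
   [n - 1] others placed in a grid with [q = 2^t] columns labelled by [F_2^t].
   The edge [v u] is coloured by the row of [u], the edge [u w] by the sum of the
   two column labels.  If [C] is even in every colour, the two neighbours of [v]
   on [C] share their row; summing the labels of all colours along the path
   [C - v] telescopes, so they also share their column, a contradiction.  The
   parity of colour [0] is never used, so the last row can reuse it.  Deleting
   colours thins the graph down to minimum degree [d], and
   [n / 2 <= q^2 <= 2 n] makes [d / q + d q / n] at most the stated bound.

   First bound for small [d]: join [2 d - n + 2] independent vertices to two
   disjoint cliques [A], [B] of order [n - d - 1], and give each of these vertices
   its own colour on its edges to [A]; everything else gets the last of these
   colours.  If [C] is even in every colour, then with one possible exception the
   independent vertices do not let [C] pass between [A] and [B]; but a closed
   walk cannot change side exactly once. *)
Require Import Defs.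
From mathcomp Require Import all_boot all_order all_algebra.
From mathcomp Require Import reals zify ring lra.

Set Implicit Arguments.
Unset Strict Implicit.
Unset Printing Implicit Defensive.

Import Order.TTheory GRing.Theory Num.Theory.
Local Open Scope ring_scope.

(** * Parity of colour classes along a cycle *)

Lemma set2_eq (T : finType) (x y x' y' : T) : [set x; y] = [set x'; y'] ->
  (x = x' /\ y = y') \/ (x = y' /\ y = x').
Proof.
move=> E.
have /set2P[] : x \in [set x'; y'] by rewrite -E set21.
  move=> xE; subst x'; left; split=> //.
  have /set2P[yx|//] : y \in [set x; y'] by rewrite -E set22.
  by have /set2P[] : y' \in [set x; y] by [rewrite E set22]; rewrite yx.
move=> xE; subst y'; right; split=> //.
have /set2P[//|yx] : y \in [set x'; x] by rewrite -E set22.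
by have /set2P[] : x' \in [set x; y] by [rewrite E set21]; rewrite yx.
Qed.

Lemma ordS_neq n (i : 'I_n) : (1 < n)%N -> ordS i != i.
Proof.
move=> n1; rewrite -val_eqE /=; have := ltn_ord i; rewrite leq_eqVlt.
case/orP=> [/eqP iE|lt_in]; last by rewrite modn_small // gtn_eqF.
by rewrite iE modnn; lia.
Qed.

Lemma ordS_ordS_neq n (i : 'I_n) : (2 < n)%N -> ordS (ordS i) != i.
Proof.
move=> n2; rewrite -val_eqE /= -addn1 modnDml -[i.+1]addn1.
have := ltn_ord i; case: (ltnP (i + 2) n) => [lt_in|le_ni] lt_i.
  by rewrite modn_small; lia.
have -> : (i + 1 + 1 = (i + 2 - n) + n)%N by lia.
by rewrite modnDr modn_small; lia.
Qed.

(** For [n > 2] distinct indices give distinct edges, so edges can be counted by index. *)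
Lemma card_imset_cycle_edges n (V : finType) (f : 'I_n -> V) (P : pred {set V}) :
  (2 < n)%N -> injective f ->
  #|[set e in [set [set f j; f (ordS j)] | j : 'I_n] | P e]| =
  #|[set j | P [set f j; f (ordS j)]]|.
Proof.
move=> n2 finj.
have Einj : injective (fun j => [set f j; f (ordS j)]).
  move=> j k /set2_eq[[/finj//]|[/finj jk /finj kj]].
  by have := ordS_ordS_neq k n2; rewrite -jk kj eqxx.
rewrite -(card_imset _ Einj); apply: eq_card => e; rewrite !inE.
apply/andP/imsetP => [[/imsetP[j _ ->] Pe]|[j]]; first by exists j; rewrite ?inE.
by rewrite inE => Pj ->; split=> //; apply: imset_f.
Qed.

Lemma copy_edges_cycle n (G : sgraph) (f : cycle_graph n -> G) : (1 < n)%N ->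
  copy_edges f = [set [set f j; f (ordS j)] | j : 'I_n].
Proof.
move=> n1; apply/setP => e; apply/imsetP/imsetP => [[e']|[j _ ->]].
  rewrite inE => /existsP[x /existsP[y /andP[xy /eqP->]]] ->.
  rewrite imsetU1 imset_set1; case/andP: xy => _ /orP[]/eqP->.
    by exists x.
  by exists y => //; rewrite setUC.
exists [set j; ordS j]; last by rewrite imsetU1 imset_set1.
rewrite inE; apply/existsP; exists j; apply/existsP; exists (ordS j).
by rewrite eqxx andbT /= /cycle_adj /= eqxx orTb andbT eq_sym ordS_neq.
Qed.

(** Lets a colouring act on ordered pairs and take values in any finite type: only [J], which
    contains the colours of the edges, is counted, and copies of the cycle become cyclic
    sequences. *)
Lemma odd_ramsey_cycle_le n (G : sgraph) (I : finType) (J : {set I})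
    (k : G -> G -> I) (r : nat) :
  (2 < n)%N -> (0 < r)%N -> (#|J| <= r)%N ->
  (forall x y, k x y = k y x) -> (forall x y : G, adj x y -> k x y \in J) ->
  (forall f : 'I_n -> G, injective f -> (forall j, adj (f j) (f (ordS j))) ->
     ~ forall i, ~~ odd #|[set j | k (f j) (f (ordS j)) == i]|) ->
  (odd_ramsey G (cycle_graph n) <= r)%N.
Proof.
move=> n2 r0 Jr ksym kJ noteven.
have n1 : (1 < n)%N by apply: ltnW.
have [_ minP] := @odd_ramseyP G (cycle_graph n) (edges_cycle_graph n1).
have [J0|[i0 i0J]] := set_0Vmem J.
  apply: minP; split=> //; exists (fun=> Ordinal r0) => f [finj fhom].
  suff : adj (f (Ordinal (ltnW n1))) (f (ordS (Ordinal (ltnW n1)))).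
    by move/kJ; rewrite J0 inE.
  by apply: fhom; rewrite /= /cycle_adj /= eqxx orTb andbT eq_sym ordS_neq.
apply: leq_trans Jr; apply: minP; split; first by apply/card_gt0P; exists i0.
(* Symmetry of [k] makes the order of the picked pair irrelevant; [i0] is a default for sets not of
   the form [[set x; y]]. *)
pose c (e : {set G}) := if [pick p : G * G | e == [set p.1; p.2]] is Some p
  then k p.1 p.2 else i0.
have cE x y : c [set x; y] = k x y.
  rewrite /c; case: pickP => [[x' y'] /= /eqP/set2_eq|/(_ (x, y))]; last first.
    by rewrite /= eqxx.
  by case=> [[-> ->//]|[-> ->]]; apply: ksym.
exists (fun e => enum_rank_in i0J (c e)) => f [finj fhom].
have fadj j : adj (f j) (f (ordS j)).
  by apply: fhom; rewrite /= /cycle_adj /= eqxx orTb andbT eq_sym ordS_neq.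
apply/existsP; apply: contra_notT (noteven f finj fadj) => /existsPn noodd i.
have [iJ|iJ] := boolP (i \in J); last first.
  rewrite (_ : [set _ | _] = set0) ?cards0 //; apply/setP => j; rewrite !inE.
  by apply: contraNF iJ => /eqP <-; apply: kJ.
have := noodd (enum_rank_in i0J i).
rewrite copy_edges_cycle // card_imset_cycle_edges //.
rewrite (_ : [set j | _] = [set j | k (f j) (f (ordS j)) == i]) //.
apply/setP => j; rewrite !inE cE; apply/eqP/eqP => [|-> //].
by apply: enum_rank_in_inj => //; apply: kJ.
Qed.

(** Each colour class contributes an even multiple of one [h i]. *)
Lemma sum_even_classes (I J : finType) (W : zmodType) (k : J -> I) (h : I -> W) :
  (forall w : W, w + w = 0) -> (forall i, ~~ odd #|[set j | k j == i]|) ->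
  \sum_j h (k j) = 0.
Proof.
move=> W2 keven; rewrite (partition_big k predT) //= big1 // => i _.
rewrite (eq_bigr (fun=> h i)) => [|j /eqP-> //].
rewrite (eq_bigl (mem [set j | k j == i])) ; last by move=> j; rewrite !inE.
rewrite sumr_const -(odd_double_half #|_|) (negbTE (keven i)) add0n.
by rewrite -mul2n mulrnA mulr2n W2 mul0rn.
Qed.

Lemma sum_cycle_edges n (W : zmodType) (l : 'I_n -> W) :
  (forall w : W, w + w = 0) -> \sum_j (l j + l (ordS j)) = 0.
Proof.
move=> W2; rewrite big_split /= [X in _ + X](_ : _ = \sum_j l j) ?W2 //.
by rewrite [RHS](reindex_inj (can_inj (@ordSK n))).
Qed.

Lemma even_card_sub2 (T : finType) (A : {set T}) (x y : T) :
  x != y -> A \subset [set x; y] -> ~~ odd #|A| -> (x \in A) = (y \in A).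
Proof.
move=> xy /subsetP sA; rewrite (cardsD1 x) (cardsD1 y) !inE.
rewrite (_ : _ :\ y = set0) ?cards0 => [|]; last first.
  apply/setP => z; rewrite !inE; apply/negP => /and3P[zy zx /sA].
  by rewrite !inE (negPf zx) (negPf zy).
by rewrite eq_sym (negPf xy) /= addn0; case: (x \in A); case: (y \in A).
Qed.

(** Modulo 2, the sum of [a j + a (ordS j)] round the cycle is 0, so [j0] cannot be the only place
    of change. *)
Lemma cycle_one_change n (a : 'I_n -> bool) (j0 : 'I_n) :
  (forall j, j != j0 -> a j = a (ordS j)) -> forall i j, a i = a j.
Proof.
move=> aS.
have F2 (w : 'F_2) : w + w = 0.
  by apply/val_inj; rewrite /= addnn -muln2 modnMl.
have a0 : a j0 = a (ordS j0).
  have := sum_cycle_edges (fun j => (a j)%:R) F2.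
  rewrite (bigD1 j0) //= big1 ?addr0 => [|j /aS <-]; last by rewrite F2.
  by case: (a _); case: (a _) => //; rewrite ?addr0 ?add0r => /eqP.
have {aS a0}aS j : a j = a (ordS j) by have [->//|/aS] := eqVneq j j0.
have n0 : (0 < n)%N by case: n j0 {a aS} => [[]|].
suff aE m (lt_mn : (m < n)%N) : a (Ordinal lt_mn) = a (Ordinal n0).
  by move=> [i lt_i] [j lt_j]; rewrite !aE.
elim: m lt_mn => [|m IH] lt_mn; first by congr a; apply: val_inj.
rewrite -(IH (ltnW lt_mn)) [RHS]aS; congr a; apply: val_inj => /=.
by rewrite modn_small.
Qed.

(** * Two cliques joined to an independent set *)

Lemma leq_min_degree (G : sgraph) (d : nat) :
  (d <= #|G|)%N -> (forall x : G, d <= degree x)%N -> (d <= min_degree G)%N.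
Proof.
move=> dG dx; rewrite /min_degree; elim/big_rec: _ => // x m _ dm.
by rewrite leq_min dx.
Qed.

(* [inl (i, b)] is the [i]-th vertex of the clique on side [b]. *)
Definition two_cliques_adj (m s : nat) : rel ('I_m * bool + 'I_s) :=
  fun x y => match x, y with
  | inl u, inl w => (u.2 == w.2) && (u.1 != w.1)
  | inr _, inr _ => false
  | _, _ => true
  end.

Lemma two_cliques_adj_sym m s : symmetric (@two_cliques_adj m s).
Proof. by move=> [u|k] [w|l] //=; rewrite (eq_sym u.2) (eq_sym u.1). Qed.

Lemma two_cliques_adj_irr m s : irreflexive (@two_cliques_adj m s).
Proof. by move=> [u|k] //=; rewrite !eqxx. Qed.

Definition two_cliques m s :=
  SGraph (@two_cliques_adj_sym m s) (@two_cliques_adj_irr m s).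

Lemma card_two_cliques m s : #|two_cliques m s| = (m.*2 + s)%N.
Proof. by rewrite /= card_sum card_prod card_bool !card_ord muln2. Qed.

(** A clique vertex misses only itself and the other clique, an independent vertex only the
    independent set. *)
Lemma two_cliques_min_degree m s d :
  (0 < m)%N -> (d <= m.*2)%N -> (d <= m + s - 1)%N ->
  (d <= min_degree (two_cliques m s))%N.
Proof.
move=> m0 d2m dms; apply: leq_min_degree.
  by rewrite card_two_cliques (leq_trans d2m) // leq_addr.
have degE (x : two_cliques m s) (B : {set two_cliques m s}) :
    (forall y, ~~ adj x y -> y \in B) -> (m.*2 + s - #|B| <= degree x)%N.
  move=> sB; rewrite /degree -card_two_cliques -(cardsC [set y | adj x y]).
  have : (#|~: [set y | adj x y]| <= #|B|)%N.
    by apply/subset_leq_card/subsetP => y; rewrite !inE; apply: sB.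
  by lia.
case=> [[i b]|k].
- apply: leq_trans (degE _ (inl (i, b) |: [set inl (j, ~~ b) | j : 'I_m]) _).
    rewrite (leq_trans dms) // cardsU1 card_imset ?card_ord => [|j j' []//].
    by case: (_ \notin _) => /=; lia.
  case=> [[j b']|l] //=; rewrite negb_and negbK !inE.
  have [-> /= /eqP->|bb' _] := eqVneq b b'; first by rewrite eqxx.
  apply/orP; right; apply/imsetP; exists j => //.
  by case: b b' bb' => -[].
- apply: leq_trans (degE _ [set inr l | l : 'I_s] _).
    by rewrite card_imset ?card_ord ?addnK // => j j' [].
  by case=> // l _; apply: imset_f.
Qed.

Lemma odd_ramsey_two_cliques n m s : (2 < n)%N -> (0 < m)%N ->
  n = (m.*2 + s.+1)%N ->
  (odd_ramsey (two_cliques m s.+1) (cycle_graph n) <= s.+1)%N.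
Proof.
move=> n2 m0 nE.
pose V := ('I_m * bool + 'I_s.+1)%type.
pose A (x : V) := if x is inl u then u.2 else false.
pose col (x y : V) : 'I_s.+1 := match x, y with
  | inl u, inr k | inr k, inl u => if u.2 then k else ord_max
  | _, _ => ord_max
  end.
apply: (@odd_ramsey_cycle_le n (two_cliques m s.+1) _ [set: _] col) => //.
- by rewrite cardsT card_ord.
- by move=> [u|k] [w|l].
move=> f finj fadj coleven.
have fsurj y : exists j, f j = y.
  have /codomP[j ->] : y \in codom f.
    by rewrite inj_card_onto // card_two_cliques card_ord nE.
  by exists j.
have [jl fjl] := fsurj (inr ord_max).
(* For [k != ord_max], colour [k] occurs only on edges from [f j] to side [true]; by parity both
   cycle edges at [f j] have it or neither does. Only the vertex at [jl] escapes this. *)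
have sides j k : f j = inr k -> j != jl -> A (f (ord_pred j)) = A (f (ordS j)).
  move=> fj jjl.
  have kmax : k != ord_max.
    by apply: contra jjl => /eqP kE; apply/eqP/finj; rewrite fj kE.
  pose B := [set i | col (f i) (f (ordS i)) == k].
  have memB i : i \in B -> i \in [set j; ord_pred j].
    rewrite !inE /col; case fi: (f i) => [u|k1]; case fi1: (f (ordS i)) => [w|k2].
    - by rewrite eq_sym (negPf kmax).
    - case: u.2; last by rewrite eq_sym (negPf kmax).
      move=> /eqP k2k; apply/orP; right; rewrite -[j](_ : ordS i = j) ?ordSK //.
      by apply: finj; rewrite fi1 fj k2k.
    - case: w.2; last by rewrite eq_sym (negPf kmax).
      by move=> /eqP k1k; rewrite (_ : i = j) ?eqxx //; apply: finj; rewrite fi fj k1k.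
    - by rewrite eq_sym (negPf kmax).
  have jp : j != ord_pred j.
    by rewrite -{1}[j]ord_predK ordS_neq // ltnW.
  have := even_card_sub2 jp _ (coleven k).
  rewrite -/B => /(_ (introT subsetP memB)).
  have := fadj j; have := fadj (ord_pred j); rewrite ord_predK !inE ord_predK fj.
  case: (f (ordS j)) => [[? b]|] //=; case: (f (ord_pred j)) => [[? b']|] //= _ _.
  by case: b; case: b'; rewrite /= ?eqxx // eq_sym (negPf kmax).
(* [a j] is the side of [f j], an independent vertex being assigned to the
   side of its successor. *)
pose a j := A (f j) || (if f j is inr _ then A (f (ordS j)) else false).
have aconst : forall i j, a i = a j.
  apply: (@cycle_one_change _ _ (ord_pred jl)) => j jjl.
  have Sjl : ordS j != jl by apply: contra jjl => /eqP <-; rewrite ordSK.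
  rewrite /a; have := fadj j; have := fun l fl => @sides (ordS j) l fl Sjl.
  case fj: (f j) => [[u b]|k]; case fj1: (f (ordS j)) => [[w b']|l] //= sd.
  - by rewrite !orbF => /andP[/eqP].
  - by rewrite -(sd _ erefl) ordSK fj /= orbF.
  - by rewrite orbF.
have [j1 f1] := fsurj (inl (Ordinal m0, true)).
have [j2 f2] := fsurj (inl (Ordinal m0, false)).
by have := aconst j1 j2; rewrite /a f1 f2.
Qed.

(** * Apex over a labelled grid *)

(* [None] is the apex, joined to the first [d] grid vertices; [g] gives the column
   labels and [K] the labels of the colours that are kept. *)
Definition apex_adj (N : nat) (T : finZmodType) (g : 'I_N -> T) (K : {set T})
    (d : nat) : rel (option 'I_N) :=
  fun x y => match x, y with
  | Some u, Some w => (u != w) && (g u + g w \in K)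
  | None, Some u | Some u, None => (u < d)%N
  | None, None => false
  end.

Lemma apex_adj_sym N T g K d : symmetric (@apex_adj N T g K d).
Proof. by move=> [u|] [w|] //=; rewrite (eq_sym u) addrC. Qed.

Lemma apex_adj_irr N T g K d : irreflexive (@apex_adj N T g K d).
Proof. by move=> [u|] //=; rewrite eqxx. Qed.

Definition apex_graph N T g K d :=
  SGraph (@apex_adj_sym N T g K d) (@apex_adj_irr N T g K d).

(** Each deleted label costs a grid vertex at most one column, that is [M] neighbours. It also
    misses itself and possibly the apex; if [d = N], where [N - 1 - d] truncates, it does meet the
    apex. *)
Lemma apex_min_degree N (T : finZmodType) (g : 'I_N -> T) (K : {set T}) d M :
  (d <= N)%N -> (forall c, #|[set u | g u == c]| <= M)%N ->
  (#|~: K| * M <= N - 1 - d)%N ->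
  (d <= min_degree (apex_graph g K d))%N.
Proof.
move=> dN gM KM; have cardV : #|apex_graph g K d| = N.+1.
  by rewrite /= card_option card_ord.
apply: leq_min_degree; first by rewrite cardV ltnW.
case=> [u|]; last first.
  rewrite /degree; have inj_some : injective (fun i : 'I_d => Some (widen_ord dN i)).
    by move=> i j [ij]; apply: val_inj.
  rewrite -[X in (X <= _)%N](card_ord d) -cardsT -(card_imset _ inj_some).
  by apply/subset_leq_card/subsetP => _ /imsetP[i _ ->]; rewrite inE /=.
pose C := [set w | g u + g w \notin K].
have del : (#|C| <= #|~: K| * M)%N.
  rewrite -sum1_card (partition_big (fun w => g u + g w) (mem (~: K))) /=; last first.
    by move=> w; rewrite !inE.
  rewrite -sum_nat_const; apply: leq_sum => c _; rewrite sum1_card.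
  apply: leq_trans (gM (c - g u)); apply/subset_leq_card/subsetP => w.
  by rewrite !inE => /andP[_ /eqP<-]; rewrite addrAC subrr add0r.
pose B : {set apex_graph g K d} := Some u |: Some @: C.
have sub : ~: [set y | adj (Some u : apex_graph g K d) y] \subset
    (if (u < d)%N then B else None |: B).
  apply/subsetP => -[w|]; rewrite !inE /=; last by case: ifP; rewrite ?inE.
  rewrite negb_and negbK => uwK.
  suff wB : Some w \in B by case: ifP; rewrite // inE wB orbT.
  rewrite !inE; case/orP: uwK => [/eqP->|uwK]; first by rewrite eqxx.
  by rewrite imset_f ?orbT ?inE.
have cB : (#|B| <= (#|~: K| * M).+1)%N.
  by rewrite cardsU1 (leq_trans (leq_add (leq_b1 _) (leq_imset_card _ _))).
have cB1 : (#|None |: B| <= (#|~: K| * M).+2)%N.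
  by rewrite cardsU1 (leq_trans (leq_add (leq_b1 _) cB)).
have := cardsC [set y | adj (Some u : apex_graph g K d) y].
rewrite cardV -/(degree (Some u : apex_graph g K d)); have := ltn_ord u.
case: ifP sub => ud /subset_leq_card sub.
  by have := leq_trans sub cB; lia.
by have := leq_trans sub cB1; lia.
Qed.

Lemma odd_ramsey_apex n N (T : finZmodType) (g : 'I_N -> T) (K : {set T}) d q r :
  (2 < n)%N -> n = N.+1 -> (forall c : T, c + c = 0) -> 0 \in K ->
  (0 < q)%N -> (d <= r.+1 * q)%N ->
  (forall u w, g u = g w -> (u %/ q = w %/ q)%N -> u = w) ->
  (odd_ramsey (apex_graph g K d) (cycle_graph n) <= r + #|K|)%N.
Proof.
move=> n2 nN T2 K0 q0 dq ginj.
have K0' : (0 < #|K|)%N by apply/card_gt0P; exists 0.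
(* [row] is [None] from row [r] on, where apex edges reuse the label colour [inr 0]. *)
pose row (u : 'I_N) : option 'I_r := insub (u %/ q)%N.
pose rowcol (u : 'I_N) : 'I_r + T := if row u is Some i then inl i else inr 0.
pose col (x y : option 'I_N) : 'I_r + T := match x, y with
  | Some u, Some w => inr (g u + g w)
  | None, Some u | Some u, None => rowcol u
  | None, None => inr 0
  end.
pose J : {set 'I_r + T} := inl @: [set: 'I_r] :|: inr @: K.
apply: (@odd_ramsey_cycle_le n (apex_graph g K d) _ J col) => //.
- by rewrite addn_gt0 K0' orbT.
- rewrite (leq_trans (leq_card_setU _ _)) // leq_add ?leq_imset_card //.
  by rewrite (leq_trans (leq_imset_card _ _)) // cardsT card_ord.
- by move=> [u|] [w|] //=; rewrite addrC.
- have rowcolJ u : rowcol u \in J.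
    rewrite inE /rowcol; case: (row u) => [i|]; apply/orP; last first.
      by right; apply: imset_f.
    by left; apply: imset_f; rewrite inE.
  move=> [u|] [w|] //= /andP[_ uwK].
  by rewrite inE; apply/orP; right; apply: imset_f.
move=> f finj fadj coleven.
have fsurj y : exists j, f j = y.
  have /codomP[j ->] : y \in codom f.
    by rewrite inj_card_onto //= card_option !card_ord nN.
  by exists j.
have [j0 f0] := fsurj None; set j1 := ord_pred j0.
have j1S : ordS j1 = j0 by rewrite ord_predK.
have fNone j : f j = None -> j = j0 by move=> fj; apply: finj; rewrite fj f0.
have [u fu] : exists u, f (ordS j0) = Some u.
  case fE: (f (ordS j0)) => [u|]; first by exists u.
  by have := ordS_neq j0 (ltnW n2); rewrite (fNone _ fE) eqxx.
have j01 : j0 != j1 by rewrite -{1}j1S ordS_neq // ltnW.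
have [w fw] : exists w, f j1 = Some w.
  case fE: (f j1) => [w|]; first by exists w.
  by move: j01; rewrite (fNone _ fE) eqxx.
have [ud wd] : (u < d)%N /\ (w < d)%N.
  by have := fadj j0; have := fadj j1; rewrite j1S f0 fu fw /=.
have uw : u != w.
  apply: contraTneq (ordS_ordS_neq j1 n2) => uw; rewrite negbK j1S.
  by apply/eqP/finj; rewrite fu fw uw.
case/eqP: uw; apply: ginj.
  (* [h] sends the colour of [x y] to [l x + l y], except on the edges at the apex. *)
  pose h (c : 'I_r + T) : T := if c is inr c' then c' else 0.
  have hrow v : h (rowcol v) = 0 by rewrite /rowcol; case: (row v).
  pose l j : T := oapp g 0 (f j).
  have := sum_even_classes h T2 coleven.
  have hE j : h (col (f j) (f (ordS j))) = l j + l (ordS j) +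
      ((if j == j0 then g u else 0) + (if j == j1 then g w else 0)).
    rewrite /l; have [->|jj0] := eqVneq j j0.
      by rewrite f0 fu (negPf j01) /= hrow add0r addr0 T2.
    have [->|jj1] := eqVneq j j1; first by rewrite j1S f0 fw /= hrow addr0 add0r T2.
    case fj: (f j) => [v|]; last by rewrite (fNone _ fj) eqxx in jj0.
    case fj1: (f (ordS j)) => [v'|] /=; first by rewrite !addr0.
    by move: jj1; rewrite /j1 -(fNone _ fj1) ordSK eqxx.
  rewrite (eq_bigr _ (fun j _ => hE j)) big_split /= sum_cycle_edges // add0r.
  rewrite big_split /= -!big_mkcond !big_pred1_eq => /eqP.
  by rewrite addr_eq0 => /eqP->; apply/eqP; rewrite eq_sym -addr_eq0 T2.
have rowE : row u = row w.
  (* Colour [inl i] can occur only on the two cycle edges at the apex. *)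
  have rowi i : (row u == Some i) = (row w == Some i).
    pose B := [set j | col (f j) (f (ordS j)) == inl i].
    have memB j : j \in B -> j \in [set j0; j1].
      rewrite !inE; case fj: (f j) => [v|]; last by rewrite (fNone _ fj) eqxx.
      case fj1: (f (ordS j)) => [v'|] //= _.
      by rewrite /j1 -(fNone _ fj1) ordSK eqxx orbT.
    have := even_card_sub2 j01 (introT subsetP memB) (coleven (inl i)).
    rewrite !inE j1S f0 fu fw /= /rowcol.
    by case: (row u) => [k|]; case: (row w) => [k'|].
  case rw: (row w) => [i|]; first by apply/eqP; rewrite rowi rw.
  by case ru: (row u) => [i|//]; have := rowi i; rewrite ru rw eqxx.
move: rowE; rewrite /row; case: insubP => [i _ iE|ru]; case: insubP => [k _ kE|rw] //.
  by move=> [ik]; rewrite -iE -kE ik.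
(* Apex neighbours lie below [d <= r.+1 * q], so outside the first [r] rows only row [r] is left. *)
have : (u %/ q < r.+1)%N /\ (w %/ q < r.+1)%N by rewrite !ltn_divLR //; lia.
lia.
Qed.

(** There are [2 ^ t] columns of at most [M] vertices, and [D] labels are deleted. The apex meets
    [(d - 1) / 2 ^ t + 1] rows, the last of which brings no new colour. *)
Lemma odd_ramsey_mindeg_apex n d t M D :
  (2 < n)%N -> (0 < d < n)%N -> (n - 1 <= M * 2 ^ t)%N -> (D * M <= n - 2 - d)%N ->
  (odd_ramsey_mindeg n d (cycle_graph n) <= d.-1 %/ 2 ^ t + (2 ^ t - D))%N.
Proof.
move=> n2 /andP[d0 dn] nM DM; set q := (2 ^ t)%N.
have q0 : (0 < q)%N by rewrite expn_gt0.
have Dq : (D < q)%N by rewrite -/q in nM; nia.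
pose T : finZmodType := 'rV['F_2]_t.
have cardT : #|T| = q by rewrite card_mx card_Fp // mul1n.
have T2 (c : T) : c + c = 0.
  apply/rowP => i; rewrite !mxE; apply/val_inj.
  by rewrite /= addnn -muln2 modnMl.
(* Vertex [u] sits in row [u / q] and column [u mod q]. *)
pose g (u : 'I_(n - 1)) : T := nth 0 (enum T) (u %% q).
have szT : size (enum T) = q by rewrite -cardE.
have ginj u w : g u = g w -> (u %/ q = w %/ q)%N -> u = w.
  move=> /eqP; rewrite nth_uniq ?enum_uniq ?szT ?ltn_mod // => /eqP um uq.
  by apply: val_inj; rewrite /= (divn_eq u q) (divn_eq w q) um uq.
have gM c : (#|[set u | g u == c]| <= M)%N.
  have uM (u : 'I_(n - 1)) : (u %/ q < M)%N.
    by rewrite ltn_divLR // (leq_trans (ltn_ord u)).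
  rewrite -[M in leqRHS]card_ord.
  apply: (@leq_card_in _ _ (fun u => Ordinal (uM u))) => u w.
  by rewrite !inE => /eqP gu /eqP gw [uw]; apply: ginj; rewrite // gu gw.
(* Label 0 is kept because its colour also serves the last row; [Dq] ensures that there are [D]
   other labels. *)
pose L : {set T} := [set c in take D (enum (predC1 (0 : T)))].
have cardL : #|L| = D.
  rewrite cardsE (card_uniqP _) ?take_uniq ?enum_uniq // size_takel //.
  by rewrite -cardE cardC1 cardT -ltnS prednK.
have L0 : 0 \in ~: L.
  by rewrite !inE; apply/negP => /mem_take; rewrite mem_enum !inE eqxx.
have [_ minP] := @odd_ramsey_mindegP n d (cycle_graph n) dn.
apply: leq_trans (minP (apex_graph g (~: L) d) _ _) _.
- by rewrite /= card_option card_ord; lia.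
- by apply: (apex_min_degree _ gM); rewrite ?setCK ?cardL; lia.
have -> : (q - D)%N = #|~: L| by rewrite cardsCs setCK cardL cardT.
apply: (odd_ramsey_apex n2 _ T2 L0 q0 _ ginj); first by lia.
by rewrite mulSn addnC -{1}(prednK d0) {1}(divn_eq d.-1 q) -addnS leq_add2l ltn_mod.
Qed.

(** * The bound [2 d - n + 2] *)

Lemma odd_ramsey_mindeg_le_sub n d : (3 < n)%N -> (n <= d.*2)%N -> (d < n)%N ->
  (odd_ramsey_mindeg n d (cycle_graph n) + n <= d.*2 + 2)%N.
Proof.
move=> n3 nd dn; have n2 : (2 < n)%N := ltnW n3.
(* For large [d], two columns and no deletion suffice, as [(d - 1) / 2 <= 2 d - n]. Otherwise
   [d <= 2 (n - d - 1)], the degree needed at the independent vertices. *)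
case: (leqP (2 * n) (3 * d + 1)) => dbig.
  have : (odd_ramsey_mindeg n d (cycle_graph n) <= d.-1 %/ 2 ^ 1 + (2 ^ 1 - 0))%N.
    by apply: (@odd_ramsey_mindeg_apex _ _ 1 n); lia.
  by rewrite expn1; lia.
have [_ minP] := @odd_ramsey_mindegP n d (cycle_graph n) dn.
pose m := (n - d - 1)%N; pose s := (d.*2 - n + 1)%N.
have nE : n = (m.*2 + s.+1)%N by rewrite /m /s; lia.
have m0 : (0 < m)%N by rewrite /m; lia.
have := odd_ramsey_two_cliques n2 m0 nE.
have : (odd_ramsey_mindeg n d (cycle_graph n) <=
    odd_ramsey (two_cliques m s.+1) (cycle_graph n))%N.
  apply: minP; first by rewrite card_two_cliques -nE.
  by apply: two_cliques_min_degree; rewrite /m /s; lia.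
by rewrite /s; lia.
Qed.

(** * The bound of order [d / sqrt n] *)

Lemma exists_exp2_sqr n : (0 < n)%N ->
  exists t, (2 ^ t * 2 ^ t <= 2 * n)%N /\ (n <= 2 * (2 ^ t * 2 ^ t))%N.
Proof.
move=> n0; have [t] : exists t, (4 ^ t <= 2 * n < 4 ^ t.+1)%N.
  exists (trunc_log 4 (2 * n)); apply: trunc_log_bounds => //; lia.
have -> : (4 ^ t.+1 = 4 * (2 ^ t * 2 ^ t))%N by rewrite expnS -expnMn.
by have -> : (4 ^ t = 2 ^ t * 2 ^ t)%N; [rewrite -expnMn|exists t; split; lia].
Qed.

(** As [M] is at most about [n / q] and [D] at least about [(n - d) / M], [q - D] is at most about
    [d q / n]; the 3 absorbs the rounding. *)
Lemma kept_labels_le n d q D M : (n <= d.*2)%N -> (d < n)%N -> (1 < q)%N ->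
  (q * q <= 2 * n)%N -> (M * q <= n - 2 + q)%N -> (n - 1 - d <= D.+1 * M)%N ->
  (n * (q - D) <= d * q + 3 * n)%N.
Proof.
case: q => [|[|p]] // nd dn _ qn Mq DM.
rewrite leqNgt mulnBr; apply/negP => lt_K.
have [e nE] : exists e, n = (d + e.+1)%N by exists (n - d - 1)%N; lia.
have lt1 : ((D + 3) * n < p.+2 * e.+1)%N.
  have : (p.+2 * n = p.+2 * d + p.+2 * e.+1)%N by rewrite nE mulnDr.
  by lia.
have le2 : (p.+2 * e <= D.+1 * (n + p))%N.
  have De : (e <= D.+1 * M)%N by lia.
  rewrite mulnC (leq_trans (leq_mul De (leqnn _))) //.
  by rewrite -mulnA leq_mul2l (leq_trans Mq) //; lia.
have le3 : (2 * D.+1 <= p.+2)%N.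
  have e2 : (2 * e.+1 <= n)%N by lia.
  have := leq_mul (leqnn p.+2) e2 => le_qn.
  have : (2 * (D + 3) * n < p.+2 * n)%N by lia.
  by rewrite ltn_mul2r => /andP[_]; lia.
(* [lt1] and [le2] give [2 n < (D + 1) p + q] with [q = p + 2]; by [le3] this yields [4 n < q ^ 2],
   against [q ^ 2 <= 2 n]. *)
by have := leq_mul le3 (leqnn p); lia.
Qed.

(** This is [d / q + d q / n + 3], for rows, kept labels and rounding, with denominators cleared. *)
Lemma odd_ramsey_mindeg_le_exp2 n d t (q := (2 ^ t)%N) :
  (3 < n)%N -> (n <= d.*2)%N -> (d < n)%N -> (1 < q)%N -> (q * q <= 2 * n)%N ->
  (q * n * odd_ramsey_mindeg n d (cycle_graph n) <= d * n + d * q * q + 3 * q * n)%N.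
Proof.
move=> n3 nd dn q1 qn.
(* [M] is [(n - 1) / q] rounded up; [D] is the largest value allowed by [DM]. *)
pose M := ((n - 2) %/ q).+1; pose D := ((n - 2 - d) %/ M)%N.
have M0 : (0 < M)%N by [].
have Mq : (n - 1 <= M * q)%N.
  by have := ltn_ceil (n - 2) (ltnW q1); rewrite -/M; lia.
have Mq' : (M * q <= n - 2 + q)%N.
  by rewrite mulSn addnC leq_add2r leq_trunc_div.
have DM : (D * M <= n - 2 - d)%N by apply: leq_trunc_div.
have DM' : (n - 1 - d <= D.+1 * M)%N.
  by have := ltn_ceil (n - 2 - d) M0; rewrite -/D; lia.
have := @odd_ramsey_mindeg_apex n d t M D (ltnW n3) _ Mq DM.
have -> : (0 < d < n)%N by rewrite dn andbT; lia.
move=> /(_ isT); rewrite -/q; set k := odd_ramsey_mindeg _ _ _ => kle.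
have row : (q * (d.-1 %/ q) <= d)%N.
  by rewrite mulnC (leq_trans (leq_trunc_div _ _)) ?leq_pred.
have Kle := kept_labels_le nd dn q1 qn Mq' DM'.
have := leq_mul (leqnn n) row; have := leq_mul (leqnn q) Kle.
have := leq_mul (leqnn (q * n)%N) kle; lia.
Qed.

Theorem proposition1p2 (R : realType) (n d : nat)
    (hn : (4 <= n)%N) (hne : ~~ odd n)
    (hd1 : n%:R / 2 <= d%:R :> R) (hd2 : (d <= n - 1)%N) :
  (odd_ramsey_mindeg n d (cycle_graph n))%:R <=
    Num.min (2 * d%:R - n%:R + 2)
            (3 * Num.sqrt 2 / 2 * (d%:R / Num.sqrt n%:R) + 3) :> R.
Proof.
have nd : (n <= d.*2)%N.
  by rewrite -mul2n -(ler_nat R) natrM mulrC -ler_pdivrMr.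
have dn : (d < n)%N by lia.
set k := odd_ramsey_mindeg _ _ _; rewrite le_min; apply/andP; split.
  have := odd_ramsey_mindeg_le_sub hn nd dn.
  by rewrite -/k -(ler_nat R) natrD natrD -mul2n natrM; lra.
have [t [qn nq]] := @exists_exp2_sqr n (ltnW (ltnW (ltnW hn))).
have q1 : (1 < 2 ^ t)%N by nia.
have kle := odd_ramsey_mindeg_le_exp2 hn nd dn q1 qn.
move: qn nq q1 kle; rewrite -/k; set q := (2 ^ t)%N => qn nq q1 kle.
have {}qn : q%:R * q%:R <= 2 * n%:R :> R by rewrite -!natrM ler_nat.
have {}nq : n%:R <= 2 * (q%:R * q%:R) :> R by rewrite -!natrM ler_nat.
have {}q1 : 1 < q%:R :> R by rewrite ltr1n.
have {}kle : q%:R * n%:R * k%:R <=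
    d%:R * n%:R + d%:R * q%:R * q%:R + 3 * q%:R * n%:R :> R.
  by rewrite -!natrM -!natrD ler_nat.
move: qn nq q1 kle.
set w := Num.sqrt n%:R; have w0 : 0 < w by rewrite sqrtr_gt0 ltr0n; lia.
have -> : n%:R = w * w :> R by rewrite -expr2 sqr_sqrtr ?ler0n.
set a := Num.sqrt 2; have a0 : 0 < a :> R by rewrite sqrtr_gt0.
have a2 : a * a = 2 :> R by rewrite -expr2 sqr_sqrtr.
have d0 : 0 <= d%:R :> R by rewrite ler0n.
(* From here [z], [x], [y] stand for [q], [k], [d], and [w], [a] for the square roots of [n] and
   2. *)
move: (q%:R) (k%:R) (d%:R) d0 => z x y y0 zw wz z1 kle.
have z0 : 0 < z by lra.
have az : w <= a * z.
  rewrite -ler_sqr ?nnegrE ?mulr_ge0 ?(ltW a0) ?(ltW z0) ?(ltW w0) //.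
  by rewrite !expr2 mulrACA a2.
have aw : z <= a * w.
  rewrite -ler_sqr ?nnegrE ?mulr_ge0 ?(ltW a0) ?(ltW z0) ?(ltW w0) //.
  by rewrite !expr2 mulrACA a2.
(* The ratio [z / w] lies between [1 / a] and [a]; the bound is an equality at both ends, so it
   follows from [(a z - w) (a w - z) >= 0]. *)
have zw3 : w * w + z * z <= 3 * a / 2 * (z * w).
  have : 0 <= (a * z - w) * (a * w - z) by rewrite mulr_ge0 // subr_ge0.
  have -> : (a * z - w) * (a * w - z) =
      (a * a + 1) * (z * w) - a * (w * w + z * z) by ring.
  rewrite a2 => h; have := mulr_ge0 (ltW a0) h.
  have -> : a * ((2 + 1) * (z * w) - a * (w * w + z * z)) =
    3 * a * (z * w) - (a * a) * (w * w + z * z) by ring.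
  by rewrite a2; lra.
have zww0 : 0 < z * (w * w) by rewrite !mulr_gt0.
rewrite -(ler_pM2l zww0) (le_trans kle) //.
have -> : z * (w * w) * (3 * a / 2 * (y / w) + 3) =
  y * (3 * a / 2 * (z * w)) + 3 * z * (w * w).
  by field; rewrite gt_eqF.
by have := ler_wpM2l y0 zw3; lra.
Qed.
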